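(* Let $G\in\mathbb{R}^{n\times n}$ be an interdependency matrix with zero diagonal, and suppose the network game with interdependency matrix $G$ has a unique Nash equilibrium (for all target vectors $\mathbf{q}\in\mathbb{R}^n$; equivalently, $I+G$ is a P-matrix). Then, for every $\mathbf{q}\in\mathbb{R}^n$, this unique equilibrium $\mathbf{x}^*$ is strongly stable, as a solution of the linear complementarity problem LCP$(I+G,-\mathbf{q})$.
   Context: A square real matrix is a P-matrix if all its principal minors are strictly positive. Network game with interdependency matrix $G$ and target vector $\mathbf{q}\in\mathbb{R}^n$: its Nash equilibria are the vectors $\mathbf{x}^*\in\mathbb{R}^n_{\geq0}$ with $x_i^*=\max\{0,q_i-\sum_j g_{ij}x_j^*\}$ for all $i$. (These arise from utilities $b_i(x_i+\sum_jg_{ij}x_j)-c_ix_i$ with $b_i$ twice differentiable, strictly increasing, strictly concave, $c_i>0$ and $b_i'(q_i)=c_i$; two-layer multiplex games correspond to $G=\kappa G^{(1)}+(1-\kappa)G^{(2)}$ and multilayer games to the block matrix $G=\begin{pmatrix} G^{(1)} & G^{(12)} \\ G^{(21)} & G^{(2)} \end{pmatrix}$.) For an $n\times n$ matrix $M$ and $\mathbf{b}\in\mathbb{R}^n$, the linear complementarity problem LCP$(M,\mathbf{b})$ asks for $\mathbf{w},\mathbf{z}\in\mathbb{R}^n$ with $\mathbf{w}-M\mathbf{z}=\mathbf{b}$, $\mathbf{w}\geq0$, $\mathbf{z}\geq0$ and $w_iz_i=0$ for all $i$; SOL$(M,\mathbf{b})$ denotes the set of solutions $\mathbf{z}$. Nash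 equilibria of the network game are exactly the elements of SOL$(I+G,-\mathbf{q})$. A solution $\mathbf{x}^*\in$ SOL$(M,\mathbf{b})$ is stable if there are neighborhoods $V$ of $\mathbf{x}^*$ and $U$ of $(M,\mathbf{b})$ such that (i) for all $(\bar M,\bar{\mathbf{b}})\in U$ the set SOL$(\bar M,\bar{\mathbf{b}})\cap V$ is nonempty, and (ii) $\sup\{\|\mathbf{y}-\mathbf{x}^*\|:\mathbf{y}\in \mathrm{SOL}(\bar M,\bar{\mathbf{b}})\cap V\}\to0$ as $(\bar M,\bar{\mathbf{b}})\to(M,\mathbf{b})$. It is strongly stable if in addition SOL$(\bar M,\bar{\mathbf{b}})\cap V$ is a singleton for all $(\bar M,\bar{\mathbf{b}})\in U$. *)

(* Defs.v *)
From HB Require Import structures.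
From mathcomp Require Export all_boot all_order all_algebra.
From mathcomp Require Export all_classical all_reals all_analysis.
Export Order.TTheory GRing.Theory Num.Theory.
Export numFieldNormedType.Exports.

Set Implicit Arguments.
Unset Strict Implicit.
Unset Printing Implicit Defensive.

Local Open Scope classical_set_scope.
Local Open Scope ring_scope.

Definition zero_diagonal (R : realType) (n : nat) (G : 'M[R]_n) : Prop :=
  forall i : 'I_n, G i i = 0.

Definition principal_minor (R : realType) (n : nat) (M : 'M[R]_n)
    (S : {set 'I_n}) : R :=
  let f : 'I_#|S| -> 'I_n := fun k => enum_val k in \det (mxsub f f M).

(* S may be empty: that minor equals 1, so it adds no condition. *)
Definition P_matrix (R : realType) (n : nat) (M : 'M[R]_n) : Prop :=
  forall S : {set 'I_n}, 0 < principal_minor M S.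

Definition nash_equilibrium (R : realType) (n : nat) (G : 'M[R]_n)
    (q x : 'cV[R]_n) : Prop :=
  forall i : 'I_n,
    0 <= x i 0 /\ x i 0 = Num.max 0 (q i 0 - \sum_(j < n) G i j * x j 0).

Definition lcp_solution (R : realType) (n : nat) (M : 'M[R]_n)
    (b w z : 'cV[R]_n) : Prop :=
  [/\ w - M *m z = b,
      forall i : 'I_n, 0 <= w i 0,
      forall i : 'I_n, 0 <= z i 0
    & forall i : 'I_n, w i 0 * z i 0 = 0].

Definition SOL (R : realType) (n : nat) (p : 'M[R]_n * 'cV[R]_n) :
    set 'cV[R]_n :=
  [set z | exists w, lcp_solution p.1 p.2 w z].

(* The supremum is taken in the extended reals, so an unbounded set of
   distances has supremum +oo and cannot tend to 0; by the first clause the set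
   is nonempty for p near (M, b), so the value -oo does not affect the limit.
   `| _ | is the max norm. *)
Definition stable_on (R : realType) (n : nat) (M : 'M[R]_n) (b x : 'cV[R]_n)
    (V : set 'cV[R]_n) (U : set ('M[R]_n * 'cV[R]_n)) : Prop :=
  [/\ nbhs x V, nbhs (M, b) U,
      forall p, U p -> SOL p `&` V !=set0
    & ereal_sup [set `|y - x|%:E | y in SOL p `&` V] @[p --> (M, b)]
        --> (0%:E : \bar R)].

Definition strongly_stable (R : realType) (n : nat) (M : 'M[R]_n)
    (b x : 'cV[R]_n) : Prop :=
  SOL (M, b) x /\
  exists V U, stable_on M b x V U /\
    forall p, U p -> exists y, SOL p `&` V = [set y].

(* Main.v *)
From HB Require Import structures.
From mathcomp Require Import perm ring lra.
Require Import Defs.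

(* M is a P-matrix iff it reverses the sign of no nonzero vector: for every
   x <> 0 some x_i (M x)_i is positive. Conversely a sign-reversed x gives two
   solutions x^+ and x^- of the same LCP, so uniqueness forces the P-property.
   By compactness of the unit sphere the sign condition becomes quantitative,
   max_i x_i (M x)_i >= c |x|^2 with c > 0. This makes solutions unique and
   1/c-Lipschitz in b, and it is stable under perturbation of M. Since solving
   LCP(N, b) amounts to solving LCP(M, b + (N - M) z) with z the unknown
   solution, Banach's theorem transfers existence from M to nearby N; moving
   along M + t I from large t down to t = 0 gives existence for M itself. The
   same reduction bounds the distance between solutions of nearby problems. *)

Set Implicit Arguments.
Unset Strict Implicit.
Local Open Scope classical_set_scope.
Local Open Scope ring_scope.

(** * P-matrices and sign reversal *)

Section SignReversal.
Context {R : realType} {n : nat}.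
Implicit Types (M : 'M[R]_n) (S : {set 'I_n}) (x : 'cV[R]_n).

(* Its determinant is the principal minor on S, with the size of the matrix kept
   equal to n, so that the minors for S and S :\ i are comparable row by row. *)
Definition pad_mx M S : 'M[R]_n :=
  \matrix_(i, j) if i \in S then M i j else (i == j)%:R.

Lemma det_mxsub_bij m (g : 'I_m -> 'I_n) M :
  bijective g -> \det (mxsub g g M) = \det M.
Proof.
move=> g_bij; have mn : m = n.
  by rewrite -(card_ord m) -(card_ord n); exact: bij_eq_card g_bij.
subst m; have g_inj := bij_inj g_bij.
have -> : mxsub g g M = row_perm (perm g_inj) (col_perm (perm g_inj) M).
  by apply/matrixP => i j; rewrite !mxE !permE.
rewrite row_permE col_permE !det_mulmx !det_perm odd_permV.
by rewrite mulrCA -signr_addb addbb mulr1.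
Qed.

(** Listing [S] before its complement makes [pad_mx M S] block upper triangular, with an identity
    block on the complement. *)
Lemma principal_minorE M S : principal_minor M S = \det (pad_mx M S).
Proof.
pose h (u : 'I_#|S| + 'I_#|~: S|) : 'I_n :=
  match u with inl a => enum_val a | inr b => enum_val b end.
have h_inj : injective h.
  move=> [a|a] [b|b] /= ab; try by rewrite (enum_val_inj ab).
    by have := enum_valP b; rewrite -ab inE enum_valP.
  by have := enum_valP a; rewrite ab inE enum_valP.
have g_bij : bijective (fun k : 'I_(#|S| + #|~: S|) => h (fintype.split k)).
  apply: inj_card_bij; last by rewrite !card_ord cardsC card_ord.
  exact: inj_comp h_inj (can_inj (@fintype.splitK _ _)).
rewrite -(det_mxsub_bij _ g_bij) -[mxsub _ _ _]submxK.
set A := ulsubmx _; set B := ursubmx _.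
set C := dlsubmx _; set D := drsubmx _.
have splitl a : fintype.split (lshift #|~: S| a) = inl a := unsplitK (inl a).
have splitr a : fintype.split (rshift #|S| a) = inr a := unsplitK (inr a).
have -> : C = 0.
  apply/matrixP => i j; rewrite !mxE splitl splitr /=.
  have := enum_valP i; rewrite inE => /negPf iS; rewrite iS.
  by case: eqP => // ij; rewrite ij enum_valP in iS.
have -> : D = 1%:M.
  apply/matrixP => i j; rewrite !mxE !splitr /=.
  have := enum_valP i; rewrite inE => /negPf ->.
  by rewrite (inj_eq enum_val_inj).
rewrite det_ublock det1 mulr1; congr (\det _).
by apply/matrixP => i j; rewrite !mxE !splitl /= enum_valP.
Qed.

Lemma P_matrix_pad M : P_matrix M <-> forall S, 0 < \det (pad_mx M S).
Proof. by split=> PM S; have := PM S; rewrite principal_minorE. Qed.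

(** The determinant is affine in row [i]: if [i] lies in [S], the minor on [S] grows by [t] times
    the minor on [S :\ i]; otherwise it is unchanged. *)
Lemma P_matrix_add_delta M t i :
  0 <= t -> P_matrix M -> P_matrix (M + t *: delta_mx i i).
Proof.
move=> t0 /P_matrix_pad PM; apply/P_matrix_pad => S.
have [iS|iS] := boolP (i \in S); last first.
  rewrite (_ : pad_mx _ S = pad_mx M S)//; apply/matrixP => j k; rewrite !mxE.
  case: ifP => // jS; case: eqP => [ji|]; first by rewrite -ji jS in iS.
  by rewrite mulr0 addr0.
rewrite (@determinant_multilinear _ _ _ (pad_mx M S) (pad_mx M (S :\ i)) i 1 t).
- by rewrite mul1r ltr_wpDr// mulr_ge0// ltW.
- by apply/rowP => j; rewrite !mxE iS !inE eqxx/= mul1r eq_sym.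
- apply/matrixP => j k; rewrite !mxE [lift i j == i]eq_sym
    (negPf (neq_lift _ _)).
  by rewrite mulr0 addr0.
- apply/matrixP => j k; rewrite !mxE !inE [lift i j == i]eq_sym
    (negPf (neq_lift _ _)).
  by rewrite mulr0 addr0.
Qed.

Lemma P_matrix_add_diag M (d : 'rV[R]_n) :
  (forall i, 0 <= d 0 i) -> P_matrix M -> P_matrix (M + diag_mx d).
Proof.
move=> d0 PM; rewrite diag_mx_sum_delta.
have addP (s : seq 'I_n) :
    P_matrix (M + \sum_(i <- s) d 0 i *: delta_mx i i).
  elim: s => [|i s IHs]; first by rewrite big_nil addr0.
  by rewrite big_cons addrCA addrC; exact: P_matrix_add_delta.
exact: addP.
Qed.

Definition reverses_sign M x := forall i, x i 0 * (M *m x) i 0 <= 0.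

(** On the support [S] of [x], sign reversal makes [d_i = - (M x)_i / x_i] nonnegative. Then
    [M + diag_mx d] is still a P-matrix, yet its padding on [S] sends [x] to 0. *)
Lemma P_matrix_reverses_sign M x : P_matrix M -> reverses_sign M x -> x = 0.
Proof.
move=> PM Mx; apply/eqP; apply: contraT => x0.
pose S : {set 'I_n} := [set i | x i 0 != 0]%SET.
pose d : 'rV[R]_n := \row_i (if i \in S then - (M *m x) i 0 / x i 0 else 0).
have d0 i : 0 <= d 0 i.
  rewrite mxE; case: ifPn => //; rewrite inE => xi0.
  rewrite -(pmulr_lge0 _ (_ : 0 < x i 0 ^+ 2)) ?exprn_even_gt0//.
  by rewrite expr2 mulrA divfK// mulNr oppr_ge0 mulrC Mx.
have /P_matrix_pad/(_ S) := P_matrix_add_diag d0 PM.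
suff /eqP -> : \det (pad_mx (M + diag_mx d) S) == 0 by rewrite ltxx.
rewrite -det_tr; apply/det0P; exists x^T; first by rewrite trmx_eq0.
rewrite -trmx_mul; apply/eqP; rewrite trmx_eq0; apply/eqP/colP => i.
have [iS|iS] := boolP (i \in S); rewrite [LHS]mxE [RHS]mxE.
  under eq_bigr => j _ do rewrite mxE iS mxE mulrDl.
  rewrite big_split/= (_ : \sum_j diag_mx d i j * x j 0 = d 0 i * x i 0).
    rewrite mxE iS divfK; last by move: iS; rewrite inE.
    by rewrite [(M *m x) i 0]mxE subrr.
  rewrite (bigD1 i)//= big1 ?addr0 ?mxE ?eqxx// => j /negPf ji.
  by rewrite mxE eq_sym ji mul0r.
rewrite (bigD1 i)//= big1 ?addr0 => [|j /negPf ji].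
  by move: iS; rewrite mxE inE negbK => /eqP ->; rewrite mulr0.
by rewrite mxE (negPf iS) eq_sym ji mul0r.
Qed.

(** If a padded determinant were nonpositive, the path from [1%:M] to [N] would meet a singular
    matrix [(1 - t) I + t N]. A kernel vector [v] vanishes off [S] and satisfies
    [(1 - t) v_i = - t (M v)_i] on [S], so [M] reverses its sign. *)
Lemma reverses_sign_P_matrix M :
  (forall x, reverses_sign M x -> x = 0) -> P_matrix M.
Proof.
move=> Mrev; apply/P_matrix_pad => S; rewrite ltNge; apply/negP => detN.
set N := pad_mx M S in detN.
(* Over polynomials, the determinant along the path is a polynomial in [t], and the intermediate
   value theorem applies. *)
pose A : 'M[{poly R}]_n := map_mx polyC 1%:M + 'X *: map_mx polyC (N - 1%:M).
have hA t : (\det A).[t] = \det (1%:M + t *: (N - 1%:M)).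
  rewrite -horner_evalE -det_map_mx; congr (\det _).
  by apply/matrixP => i j; rewrite !mxE /= /horner_eval !hornerE.
have [||t /andP[t0 t1] /rootP] := @poly_ivt R (- \det A) 0 1; first by [].
  rewrite !hornerN !hA scale0r addr0 det1 scale1r addrC subrK.
  by rewrite lerN10 oppr_ge0.
rewrite hornerN hA => /eqP; rewrite oppr_eq0 -det_tr.
case/det0P => v v0 /(congr1 trmx); rewrite trmx_mul trmxK trmx0 => Nv.
suff /Mrev/eqP : reverses_sign M v^T by rewrite trmx_eq0 (negPf v0).
move=> i; move/colP/(_ i): Nv.
rewrite mulmxDl mul1mx -scalemxAl mulmxBl mul1mx.
have NvE : (N *m v^T) i 0 = if i \in S then (M *m v^T) i 0 else v 0 i.
  case: ifPn => iS; rewrite !mxE.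
    by apply: eq_bigr => j _; rewrite mxE iS.
  rewrite (bigD1 i)//= big1 ?addr0 => [|j /negPf ji].
    by rewrite !mxE (negPf iS) eqxx mul1r.
  by rewrite !mxE (negPf iS) eq_sym ji mul0r.
move: (N *m v^T) NvE => y; rewrite [v^T i 0]mxE; set m := (M *m _) i 0.
case: ifP => _ yE; rewrite !mxE yE => Nv; last first.
  by move: Nv; rewrite subrr mulr0 addr0 => ->; rewrite mul0r.
have {}Nv : (1 - t) * v 0 i = - (t * m) by lra.
have [t00|tn0] := eqVneq t 0.
  by move: Nv; rewrite t00 subr0 mul1r mul0r oppr0 => ->; rewrite mul0r.
have {}t0 : 0 < t by rewrite lt_def tn0.
have : 0 <= (1 - t) * v 0 i ^+ 2 by rewrite mulr_ge0 ?sqr_ge0// subr_ge0.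
by rewrite expr2 mulrA Nv mulNr oppr_ge0 -mulrA pmulr_rle0// mulrC.
Qed.

End SignReversal.

(** * Estimates for the entrywise maximum norm *)

Section MatrixNorm.
Context {R : realType}.

Lemma ler_entry_norm m n (A : 'M[R]_(m, n)) i j : `|A i j| <= `|A|.
Proof.
rewrite [leRHS]/Num.norm/= mx_normrE.
exact: (le_bigmax _ (fun ij => `|A ij.1 ij.2|) (i, j)).
Qed.

Lemma mx_norm_le m n (A : 'M[R]_(m, n)) b :
  0 <= b -> (forall i j, `|A i j| <= b) -> `|A| <= b.
Proof.
move=> b0 Ab; rewrite [leLHS]/Num.norm/= mx_normrE.
by apply: bigmax_le => // -[i j] _; exact: Ab.
Qed.

Lemma ler_norm_mulmx m n p (A : 'M[R]_(m, n)) (B : 'M[R]_(n, p)) :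
  `|A *m B| <= n%:R * `|A| * `|B|.
Proof.
apply: mx_norm_le => [|i j]; first by rewrite !mulr_ge0.
rewrite mxE (le_trans (ler_norm_sum _ _ _))//.
have -> : n%:R * `|A| * `|B| = \sum_(k < n) `|A| * `|B|.
  by rewrite sumr_const card_ord -mulrA mulr_natl.
by apply: ler_sum => k _; rewrite normrM ler_pM// ler_entry_norm.
Qed.

Lemma norm_scalar_mx_le n (t : R) : `|t%:M : 'M[R]_n| <= `|t|.
Proof.
apply: mx_norm_le => // i j; rewrite mxE.
by case: eqP => _; rewrite ?mulr1n ?mulr0n ?normr0.
Qed.

Lemma norm_trmx m n (A : 'M[R]_(m, n)) : `|A^T| = `|A|.
Proof.
have le_tr p q (B : 'M[R]_(p, q)) : `|B^T| <= `|B|.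
  by apply: mx_norm_le => // i j; rewrite mxE ler_entry_norm.
by apply/eqP; rewrite eq_le le_tr -{1}[A]trmxK le_tr.
Qed.

End MatrixNorm.

(** * The quantitative sign condition *)

Section SignCoercive.
Context {R : realType} {n : nat}.
Implicit Types (M N : 'M[R]_n) (x : 'cV[R]_n) (c t : R).

(** An index in place of a maximum over [i] avoids a maximum over the empty set; for [n = 0] the
    condition is vacuous. *)
Definition sign_coercive c M := forall x, x != 0 ->
  exists i, c * `|x| ^+ 2 <= x i 0 * (M *m x) i 0.

Lemma continuous_sum_max_mul M :
  continuous (fun v : 'rV[R]_n => \sum_i Num.max 0 (v 0 i * (M *m v^T) i 0)).
Proof.
have coordM_cont i : continuous (fun v : 'rV[R]_n => (M *m v^T) i 0).
  under eq_fun do rewrite mxE.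
  apply: continuous_big => [|j _ v]; first exact: add_continuous.
  under eq_fun do rewrite mxE.
  apply: (@continuousM _ _ (cst (M i j)) (fun v : 'rV[R]_n => v 0 j)).
    exact: cst_continuous.
  exact: (@coord_continuous _ _ _ 0 j v).
apply: continuous_big => [|i _ v]; first exact: add_continuous.
apply: (@continuous_max _ _ (cst 0)
  (fun v : 'rV[R]_n => v 0 i * (M *m v^T) i 0)).
  exact: cst_continuous.
apply: (@continuousM _ _ (fun v : 'rV[R]_n => v 0 i)
  (fun v : 'rV[R]_n => (M *m v^T) i 0)).
  exact: (@coord_continuous _ _ _ 0 i v).
exact: coordM_cont.
Qed.

(** The sum [f] of the positive parts of [v_i (M v)_i] is continuous, and positive off 0 because no
    nonzero vector is sign-reversed. Its minimum on the unit sphere is thus positive, and scaling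
    gives the factor [|x|^2]. *)
Lemma P_matrix_sign_coercive M :
  P_matrix M -> exists2 c, 0 < c & sign_coercive c M.
Proof.
move=> PM; pose K := [set v : 'rV[R]_n | `|v| = 1].
pose f (v : 'rV[R]_n) := \sum_i Num.max 0 (v 0 i * (M *m v^T) i 0).
have f_gt0 v : v != 0 -> 0 < f v.
  move=> v0; rewrite lt_def sumr_ge0 ?andbT => [|i _].
    2: by rewrite le_max lexx.
  apply: contra_neq v0 => /eqP.
  rewrite psumr_eq0 => [|i _]; last by rewrite le_max lexx.
  move=> /allP fv; apply: trmx_inj; rewrite trmx0.
  apply: (P_matrix_reverses_sign PM) => i.
  have /eqP := fv i (mem_index_enum i).
  by rewrite [v^T i 0]mxE => /max_idPl.
have K_unit x : x != 0 -> K (`|x|^-1 *: x)^T.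
  by move=> x0; rewrite /K/= norm_trmx normrZ normfV normr_id mulVf// normr_eq0.
(* The sphere is empty only when there is no nonzero vector; any constant then works. *)
have [K0|/set0P K0] := eqVneq K set0.
  exists 1; first exact: ltr01.
  by move=> x /K_unit; rewrite K0.
have Kcompact : compact K.
  apply: bounded_closed_compact.
    by exists 1; split => // b b1 v /= ->; exact: ltW.
  apply: (@preimage_closed _ _ (fun v : 'rV[R]_n => `|v|) [set 1]).
    by move=> v _; exact: norm_continuous.
  exact: closed_eq.
have [v /set_mem Kv fv] := compact_EVT_min K0 Kcompact
  (continuous_subspaceT (@continuous_sum_max_mul M)).
have fv_gt0 : 0 < f v.
  by apply: f_gt0; rewrite -normr_eq0 (Kv : `|v| = 1) oner_neq0.
(* If all [n] terms were at most this constant, their sum would be strictly below the minimum;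
   [n.+1] gives the strictness. *)
exists (f v / n.+1%:R) => [|x x0]; first exact: divr_gt0.
apply/not_existsP => small.
have /mem_set/fv := K_unit _ x0; apply/negP; rewrite -ltNge.
set u := `|x|^-1 *: x.
have xn0 : 0 < `|x| by rewrite normr_gt0.
have le_u i : Num.max 0 (u i 0 * (M *m u) i 0) <= f v / n.+1%:R.
  rewrite ge_max divr_ge0 ?(ltW fv_gt0)//=.
  have /negP := small i; rewrite -ltNge => /ltW.
  rewrite /u -scalemxAr !mxE -/(x i 0).
  set m := \sum_j _ => le_x.
  by rewrite mulrACA -invfM -expr2 mulrC ler_pdivrMr ?exprn_gt0.
apply: (@le_lt_trans _ _ (\sum_(i < n) f v / n.+1%:R)).
  by apply: ler_sum => i _; rewrite trmxK mxE.
rewrite sumr_const card_ord -[_ *+ n]mulr_natr -mulrA gtr_pMr//.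
by rewrite mulrC ltr_pdivrMr// mul1r ltr_nat.
Qed.

End SignCoercive.

(* The library has both structures but not their join, which the fixed point
   theorem needs. *)
HB.instance Definition _ (R : realType) m n := Complete.on 'M[R]_(m, n).

(** * Existence, uniqueness and perturbation of LCP solutions *)

Section LCP.
Context {R : realType} {n : nat}.
Implicit Types (M N : 'M[R]_n) (b x z : 'cV[R]_n) (c t : R).

(** Complementarity gives [(z - z')_i (w - w')_i = - (w_i z'_i + w'_i z_i) <= 0] for every [i]. At
    the coercive index only the term in [b - b'] remains, bounded by [|z - z'| |b - b'|]. *)
Lemma SOL_lipschitz c M b b' z z' : sign_coercive c M ->
  SOL (M, b) z -> SOL (M, b') z' -> c * `|z - z'| <= `|b - b'|.
Proof.
move=> Mc [w [/= wE w0 z0 wz]] [w' [/= w'E w'0 z'0 wz']].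
have [->|u0] := eqVneq (z - z') 0; first by rewrite normr0 mulr0.
have [i] := Mc _ u0.
have -> : M *m (z - z') = (w - w') - (b - b').
  by rewrite -wE -w'E mulmxBr; apply/matrixP => j k; rewrite !mxE; ring.
set u := z - z'; set d := b - b' => le_u.
have u_gt0 : 0 < `|u| by rewrite normr_gt0.
rewrite -(ler_pM2l u_gt0) mulrCA -expr2 (le_trans le_u)//.
rewrite [X in _ * X]mxE mulrDr.
apply: (@le_trans _ _ (0 + `|u| * `|d|)); last by rewrite add0r.
apply: lerD; last first.
  rewrite [(- d) i 0]mxE (le_trans (ler_norm _))// normrM normrN.
  by rewrite ler_pM// ler_entry_norm.
rewrite !mxE; have := wz i; have := wz' i.
have := mulr_ge0 (w0 i) (z'0 i); have := mulr_ge0 (w'0 i) (z0 i).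
lra.
Qed.

Lemma SOL_perturb M N b z :
  SOL (N, b) z <-> SOL (M, b + (N - M) *m z) z.
Proof.
have wE w : (w - N *m z = b) <-> (w - M *m z = b + (N - M) *m z).
  rewrite mulmxBl; split => [wb|/eqP].
    by rewrite -wb addrA subrK.
  by rewrite addrA -subr_eq opprK subrK -subr_eq => /eqP.
by split=> -[w [/= /wE ? ? ? ?]]; exists w; split.
Qed.

(** A solution for [N] is a fixed point of [z |-> sol (b + (N - M) z)], a contraction of ratio
    [n |N - M| / c] by [SOL_lipschitz]. *)
Lemma SOL_nonempty_perturb c M N : sign_coercive c M ->
  (forall b, SOL (M, b) !=set0) -> n%:R * `|N - M| < c ->
  forall b, SOL (N, b) !=set0.
Proof.
move=> Mc /choice[sol solP] lt_c b.
have c0 : 0 < c by apply: le_lt_trans lt_c; rewrite mulr_ge0.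
pose f : {fun [set: 'cV[R]_n] >-> [set: 'cV[R]_n]} :=
  [fun of totalfun (fun z => sol (b + (N - M) *m z))].
have q0 : 0 <= n%:R * `|N - M| / c by rewrite divr_ge0 ?mulr_ge0// ltW.
have f_contr : is_contraction f.
  exists (NngNum q0); split => /=; first by rewrite ltr_pdivrMr// mul1r.
  move=> [z z'] _ /=.
  rewrite -(ler_pM2l c0) (le_trans (SOL_lipschitz Mc (solP _) (solP _)))//.
  rewrite opprD addrACA subrr add0r -mulmxBr mulrA [c * _]mulrC divfK ?gt_eqF//.
  exact: ler_norm_mulmx.
have [z _ zE] := banach_fixed_point f_contr closedT (ex_intro _ 0 I).
by exists z; apply/(SOL_perturb M); rewrite {2}zE; exact: solP.
Qed.

Lemma SOL_scalar_nonempty t b : 0 < t -> SOL (t%:M, b) !=set0.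
Proof.
(* The coordinates decouple: [w] is the positive part of [b], and [z] is its negative part divided
   by [t]. *)
move=> t0; exists (\col_i Num.max 0 (- b i 0 / t)), (\col_i Num.max 0 (b i 0)).
have bE i : Num.max 0 (b i 0) - t * Num.max 0 (- b i 0 / t) = b i 0.
  rewrite maxr_pMr ?ltW// mulr0 [t * _]mulrC divfK ?gt_eqF//.
  by rewrite /Num.max; do 2 case: ifPn; rewrite -?leNgt; lra.
split=> [|i|i|i]; rewrite ?mxE ?le_max ?lexx//.
  by apply/colP => i; rewrite mul_scalar_mx !mxE bE.
case: (ltP 0 (b i 0)) => b0; last by rewrite mul0r.
by rewrite max_l ?mulr0// pmulr_lle0 ?invr_gt0// oppr_le0 ltW.
Qed.

Lemma sign_coercive_scalar t : sign_coercive t (t%:M : 'M[R]_n).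
Proof.
move=> x; rewrite -normr_eq0 => /mx_norm_neq0[[i j] /= xE].
exists i; rewrite [`|x|]xE (ord1 j) mul_scalar_mx [X in _ <= _ * X]mxE.
by rewrite [leRHS]mulrCA -expr2 real_normK ?num_real.
Qed.

Lemma sign_coercive_shift c t M : 0 <= t ->
  sign_coercive c M -> sign_coercive c (M + t%:M).
Proof.
move=> t0 Mc x /Mc[i le_x]; exists i; apply: (le_trans le_x).
rewrite mulmxDl mul_scalar_mx [X in _ <= _ * X]mxE mulrDr lerDl.
rewrite [X in _ * X]mxE mulrCA.
by rewrite mulr_ge0// -expr2 sqr_ge0.
Qed.

(* For large t, M + t I is a small perturbation of t I; then t is decreased to 0
   in steps of constant length, since the coercivity constant of M serves for
   every M + t I. *)
Lemma sign_coercive_SOL_nonempty c M : 0 < c ->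
  sign_coercive c M -> forall b, SOL (M, b) !=set0.
Proof.
(* This step length gives [n * d < c], as [SOL_nonempty_perturb] requires. *)
move=> c0 Mc; pose d := c / n.+1%:R.
have d0 : 0 < d by rewrite divr_gt0.
pose solvable k := forall b, SOL (M + (k%:R * d)%:M, b) !=set0.
have solvable_large : exists k, solvable k.
  have [k] : exists k : nat, n%:R * `|M| < k%:R * d.
    exists (Num.bound (n%:R * `|M| / d)).
    by rewrite -ltr_pdivrMr// archi_boundP// divr_ge0 ?mulr_ge0// ltW.
  move=> lt_k; exists k.
  apply: (SOL_nonempty_perturb (@sign_coercive_scalar (k%:R * d))).
    move=> b; apply: SOL_scalar_nonempty; apply: le_lt_trans lt_k.
    by rewrite mulr_ge0.
  by rewrite addrK.
case: solvable_large; elim=> [|k IHk] solvable_k.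
  by move=> b; have := solvable_k b; rewrite mul0r raddf0 addr0.
apply: IHk; apply: (SOL_nonempty_perturb _ solvable_k).
  by apply: sign_coercive_shift Mc; rewrite mulr_ge0// ltW.
rewrite opprD addrACA subrr add0r -raddfB -mulrBl -natr1 opprD.
rewrite addrA subrr sub0r mulN1r (@le_lt_trans _ _ (n%:R * d))//.
  by rewrite ler_wpM2l// (le_trans (norm_scalar_mx_le _ _))// normrN gtr0_norm.
by rewrite mulrCA gtr_pMr// ltr_pdivrMr// mul1r ltr_nat.
Qed.

(** The same index serves: [x_i ((N - M) x)_i] is at least [- n |N - M| |x|^2]. *)
Lemma sign_coercive_perturb c M N : sign_coercive c M ->
  sign_coercive (c - n%:R * `|N - M|) N.
Proof.
move=> Mc x /Mc[i le_x]; exists i.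
have -> : N = M + (N - M) by rewrite addrC subrK.
set D := N - M; rewrite addrAC subrr add0r.
rewrite mulmxDl [X in _ <= _ * X]mxE mulrDr mulrBl lerD//.
rewrite lerNl -mulrN (le_trans (ler_norm _))// normrM normrN expr2 mulrCA.
rewrite ler_pM// ?ler_entry_norm//.
by rewrite (le_trans (ler_entry_norm _ _ _)) ?ler_norm_mulmx.
Qed.

(** The slack [w_i] is [x_i] minus the argument of the maximum, so the equilibrium equation
    [x_i = max 0 (x_i - w_i)] is complementarity of [x_i] and [w_i]. *)
Lemma nash_SOL (G : 'M[R]_n) q x :
  nash_equilibrium G q x <-> SOL (1%:M + G, - q) x.
Proof.
have wE i : ((1%:M + G) *m x - q) i 0 =
    x i 0 - (q i 0 - \sum_(j < n) G i j * x j 0).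
  by rewrite mulmxDl mul1mx !mxE; ring.
split=> [Gx|[w [/= /eqP + w0 x0 wx]] i].
  exists ((1%:M + G) *m x - q); split => /= [|i|i|i].
  - by rewrite addrAC subrr add0r.
  - by have [_ xE] := Gx i; rewrite wE subr_ge0 [leRHS]xE le_max lexx orbT.
  - by have [] := Gx i.
  - have [x0 xE] := Gx i; rewrite wE; move: xE.
    by case: ltP => _ ->; rewrite ?subrr ?mul0r ?mulr0.
rewrite subr_eq addrC => /eqP wxE; split; first exact: x0.
have := w0 i; have /eqP := wx i.
rewrite wxE wE mulf_eq0 => /orP[/eqP/subr0_eq <- _|/eqP -> w_ge0].
  by rewrite max_r.
by rewrite max_l//; move: w_ge0; rewrite sub0r oppr_ge0.
Qed.

End LCP.

(** * Strong stability, and uniqueness implies the P-property *)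

Section Stability.
Context {R : realType} {n : nat}.
Implicit Types (M G : 'M[R]_n) (b x : 'cV[R]_n) (c : R).

Lemma SOL_sign_coercive_set1 c M b :
  0 < c -> sign_coercive c M -> exists y, SOL (M, b) = [set y].
Proof.
move=> c0 Mc; have [y ySOL] := sign_coercive_SOL_nonempty c0 Mc b.
exists y; apply/seteqP; split=> [z zSOL|z ->//].
have := SOL_lipschitz Mc zSOL ySOL.
by rewrite subrr normr0 pmulr_rle0// normr_le0 subr_eq0 => /eqP.
Qed.

Lemma P_matrix_strongly_stable M b x :
  P_matrix M -> SOL (M, b) x -> strongly_stable M b x.
Proof.
move=> /P_matrix_sign_coercive[c c0 Mc] xSOL; split=> //.
have c20 : 0 < c / 2 by rewrite divr_gt0.
pose h (p : 'M[R]_n * 'cV[R]_n) := n%:R * `|M - p.1|.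
have h0 : h p @[p --> (M, b)] --> 0.
  rewrite -(mulr0 n%:R); apply: cvgMr.
  rewrite -(normr0 'M[R]_n) -(subrr M); apply: cvg_norm.
  by apply: cvgB; [exact: cvg_cst|exact: cvg_fst].
(* On [U] the coercivity constant drops by at most half, so [c / 2] serves for all these problems at
   once. *)
pose U := [set p | h p <= c / 2].
have U_nbhs : nbhs (M, b) U by apply: cvgr_le h0 _ _.
have U_coercive p : U p -> sign_coercive (c / 2) p.1.
  move=> Up y /(sign_coercive_perturb p.1 Mc)[i le_y].
  exists i; apply: le_trans le_y; rewrite ler_wpM2r// ?exprn_ge0//.
  by move: Up; rewrite /U/= /h distrC; lra.
have SOL_U p : U p -> exists y, SOL p = [set y].
  by case: p => N d Up; exact: SOL_sign_coercive_set1 c20 (U_coercive _ Up).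
(* Uniqueness on [U] is global, so [V] can be the whole space. *)
exists setT, U; split; last by move=> p /SOL_U; rewrite setIT.
split=> //; first exact: filterT.
  by move=> p /SOL_U[y ->]; exists y.
pose g p := (c / 2)^-1 * (`|p.2 - b| + h p * `|x|).
apply: (@squeeze_cvge _ _ _ _ (cst 0%E) _ (EFin \o g)); first last.
- apply: cvg_EFin; first exact: nearW.
  have -> : 0 = (c / 2)^-1 * (0 + 0 * `|x|) by rewrite mul0r addr0 mulr0.
  apply: cvgMr; apply: cvgD; last exact: cvgMl.
  rewrite -(normr0 'cV[R]_n) -(subrr b); apply: cvg_norm.
  by apply: cvgB; [exact: cvg_snd|exact: cvg_cst].
- exact: cvg_cst.
near=> p; have Up : U p by near: p.
rewrite setIT.
have [y yE] := SOL_U p Up.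
rewrite yE image_set1 ereal_sup1 !lee_fin normr_ge0/= /g.
rewrite ler_pdivlMl//.
have {}yE : SOL p y by rewrite yE.
(* Now [x] solves a problem with matrix [p.1] and a shifted target, so the Lipschitz bound compares
   it with [y]. *)
have /(SOL_perturb p.1) x'SOL := xSOL.
apply: (le_trans (SOL_lipschitz (U_coercive p Up)
  (yE : SOL (p.1, p.2) y) x'SOL)).
rewrite opprD addrA (le_trans (ler_normB _ _))// lerD2l.
exact: ler_norm_mulmx.
Unshelve. all: by end_near. Qed.

(* The positive and negative parts of a sign-reversed vector both solve the
   same problem. *)
Lemma SOL_unique_reverses_sign M x :
  (forall b z z', SOL (M, b) z -> SOL (M, b) z' -> z = z') ->
  reverses_sign M x -> x = 0.
Proof.
move=> uniq Mx.
pose pos (v : 'cV[R]_n) : 'cV[R]_n := \col_i Num.max 0 (v i 0).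
have posB v : pos v - pos (- v) = v.
  apply/colP => i; rewrite !mxE /Num.max oppr_gt0.
  by case: ltgtP => // v0; lra.
have pos_ge0 v i : 0 <= pos v i 0 by rewrite mxE le_max lexx.
have pos_disj (a d : R) : d * a <= 0 -> Num.max 0 a * Num.max 0 d = 0.
  rewrite /Num.max; case: ltP => a0; case: ltP => d0; rewrite ?mul0r ?mulr0//.
  by rewrite leNgt mulr_gt0.
rewrite -[LHS]posB; apply/eqP; rewrite subr_eq0; apply/eqP.
(* This target also equals [pos (- (M *m x)) - M *m pos (- x)], since [pos v - pos (- v) = v] for
   both [x] and [M *m x]. The slacks are the two parts of [M *m x]. *)
apply: (uniq (pos (M *m x) - M *m pos x)).
  exists (pos (M *m x)); split=> //= i.
  by rewrite [pos _ i 0]mxE [pos x i 0]mxE pos_disj// Mx.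
exists (pos (- (M *m x))); split=> //= [|i].
  have : pos (M *m x) - pos (- (M *m x)) = M *m (pos x - pos (- x)).
    by rewrite !posB.
  rewrite mulmxBr => /eqP; rewrite subr_eq => /eqP ->.
  by apply/matrixP => i j; rewrite !mxE; ring.
rewrite [pos _ i 0]mxE [pos (- x) i 0]mxE [(- (M *m x)) i 0]mxE [(- x) i 0]mxE.
by rewrite pos_disj// mulrNN Mx.
Qed.

End Stability.

Theorem proposition8 (R : realType) (n : nat) (G : 'M[R]_n)
    (hG : zero_diagonal G) :
  ((forall q : 'cV[R]_n, exists! x : 'cV[R]_n, nash_equilibrium G q x) <->
     P_matrix (1%:M + G)) /\
  ((forall q : 'cV[R]_n, exists! x : 'cV[R]_n, nash_equilibrium G q x) ->
     forall q x : 'cV[R]_n, nash_equilibrium G q x ->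
       strongly_stable (1%:M + G) (- q) x).
Proof.
have uniqP : (forall q, exists! x, nash_equilibrium G q x) <->
    P_matrix (1%:M + G).
  split=> [uniq|/P_matrix_sign_coercive[c c0 Mc] q].
    apply: reverses_sign_P_matrix => x.
    apply: SOL_unique_reverses_sign => b z z'.
    have [y [_ y_uniq]] := uniq (- b).
    by rewrite -[b]opprK => /nash_SOL/y_uniq <- /nash_SOL/y_uniq <-.
  have [y yE] := SOL_sign_coercive_set1 (- q) c0 Mc.
  exists y; split=> [|z /nash_SOL]; first by apply/nash_SOL; rewrite yE.
  by rewrite yE.
split=> // /uniqP PM q x /nash_SOL; exact: P_matrix_strongly_stable.
Qed.
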